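(* Let $\alpha \leq \kappa(\mathfrak{Small})$ be a regular cardinal that is also a strong limit cardinal, and let $\mathfrak{J}_\alpha$ be a set of $\alpha$-small sets containing all $\alpha$-small cardinals. Let $(\Sigma,A)$ be a $\mathfrak{J}_\alpha$-ary algebra whose underlying set $A$ is $\alpha$-small. Then the following are equivalent: (1) the $\mathfrak{J}_\alpha$-ary double centralizer clone $(\Sigma^A)^{\perp\perp}$ is equal to the clone of $\mathfrak{J}_\alpha$-ary derived operations $\langle \Sigma^A\rangle_\alpha$; (2) for every $\mathfrak{J}_\alpha$-ary operation $f:A^J \rightarrow A$, if $f \notin \langle \Sigma^A\rangle_\alpha$ then there exists some $\Sigma$-homomorphism $h:A^{(A^J)} \rightarrow A$ such that $h(f) \neq f(h \circ u_J)$, where $u_J:J\to A^{(A^J)}$ is the map that sends each $j\in J$ to the projection $\pi_j:A^J\to A$.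
   Context: Fix a Grothendieck universe $\mathfrak{Small}$, i.e. the set of all sets of rank less than a fixed inaccessible cardinal $\kappa = \kappa(\mathfrak{Small})$; its elements are called small sets. Let $\alpha \leq \kappa(\mathfrak{Small})$ be an (infinite) regular cardinal. It is a strong limit cardinal if $2^\beta<\alpha$ for every cardinal $\beta<\alpha$. A set is $\alpha$-small if it is small and has cardinality less than $\alpha$. Fix a set $\mathfrak{J}_\alpha$ of sets with $\mathfrak{Card}_\alpha \subseteq \mathfrak{J}_\alpha \subseteq \mathfrak{Small}_\alpha$, where $\mathfrak{Card}_\alpha$ is the set of all $\alpha$-small cardinals and $\mathfrak{Small}_\alpha$ is the set of all $\alpha$-small sets. Given a set $A$, a $\mathfrak{J}_\alpha$-ary operation on $A$ is a map $A^J \to A$ with $J \in \mathfrak{J}_\alpha$ (its arity); nullary operations are allowed. A $\mathfrak{J}_\alpha$-ary signature is a (possibly large) set $\Sigma$ with an assignment of an arity in $\mathfrak{J}_\alpha$ to each $\sigma\in\Sigma$. A $\Sigma$-algebra is a set $A$ equipped with an operation $\sigma^A:A^J\to A$ for each $\sigma\in\Sigma$, where $J$ is the arity of $\sigma$; a $\Sigma$-homomorphism is a map preserving these basic operations. A $\mathfrak{J}_\alpha$-ary algebra is a pair $(\Sigma,A)$ of a $\mathfrak{J}_\alpha$-ary signature $\Sigma$ and a $\Sigma$-algebra $A$; write $\Sigma^A=\{\sigma^A\mid\sigma\in\Sigma\}$. Each power $A^Y$ is a $\Sigma$-algebra under the pointwise operations; in particular $A^{(A^J)}$ is a $\Sigma$-algebra.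 A $\mathfrak{J}_\alpha$-ary clone on $A$ is a set $F$ of $\mathfrak{J}_\alpha$-ary operations on $A$ that contains all projections $\pi_j:A^J\to A$ ($J\in\mathfrak{J}_\alpha$, $j\in J$) and is such that for all $J,K\in\mathfrak{J}_\alpha$, every $f:A^K\to A$ in $F$ and every family $g_k:A^J\to A$ $(k\in K)$ in $F$, the composite $f\circ(g_k)_{k\in K}:A^J\to A$ lies in $F$. The clone of $\mathfrak{J}_\alpha$-ary derived operations $\langle\Sigma^A\rangle_\alpha$ of $(\Sigma,A)$ is the smallest $\mathfrak{J}_\alpha$-ary clone on $A$ containing $\Sigma^A$. Operations $f:A^X\to A$ and $g:A^Y\to A$ commute, written $f\perp g$, if for every matrix $a=(a_{xy})\in A^{X\times Y}$ one has $g\bigl((f((a_{xy})_{x\in X}))_{y\in Y}\bigr)=f\bigl((g((a_{xy})_{y\in Y}))_{x\in X}\bigr)$. For a set $G$ of $\mathfrak{J}_\alpha$-ary operations on $A$, $G^\perp$ is the set of all $\mathfrak{J}_\alpha$-ary operations $f$ on $A$ with $f\perp g$ for all $g\in G$, and $G^{\perp\perp}=(G^\perp)^\perp$. In $h(f)$, the map $f:A^J\to A$ is regarded as an element of $A^{(A^J)}$; and $h\circ u_J:J\to A$ is regarded as an element of $A^J$. *)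

(* Defs.v *)
From mathcomp Require Import all_boot.
From mathcomp Require Import mathcomp_extra boolp classical_sets functions.
From mathcomp Require Import cardinality wochoice.

Set Implicit Arguments.
Unset Strict Implicit.
Unset Printing Implicit Defensive.

Local Open Scope classical_set_scope.
Local Open Scope card_scope.

Definition card_lt T U (A : set T) (B : set U) : Prop := A #<= B /\ A #!= B.

Notation "A '#<' B" := (card_lt A B) (at level 79, format "A  '#<'  B") :
  card_scope.

(* A cardinal is an initial ordinal, given as a well-ordered type. An ordinal
   below alpha is an element b : alpha, standing for the von Neumann ordinal
   {x : alpha | clt x b}. Plain relations are used rather than orderType because
   the universe constraints of orderType rule out sets of types that contain
   such initial segments. *)
Definition strict_of (T : Type) (le : rel T) : rel T := fun x y => ~~ le y x.

Record cardinal := Cardinal {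
  elements :> Type;
  cle : rel elements;
  cle_well_order : well_order cle;
  cle_initial : forall b : elements,
    [set x | strict_of cle x b] #< [set: elements]
}.

Definition clt (alpha : cardinal) : rel alpha := strict_of (@cle alpha).

Definition is_cardinal_below (alpha : cardinal) (b : alpha) : Prop :=
  forall c : alpha, clt c b -> [set x | clt x c] #< [set x | clt x b].

(* The second condition says that the cofinality of alpha is alpha. *)
Definition regular (alpha : cardinal) : Prop :=
  infinite_set [set: alpha] /\
  forall S : set alpha, S #< [set: alpha] ->
    exists b : alpha, forall x, S x -> clt x b.

Definition strong_limit (alpha : cardinal) : Prop :=
  forall b : alpha, is_cardinal_below b ->
    [set: {x : alpha | clt x b} -> bool] #< [set: alpha].

Definition inaccessible (kappa : cardinal) : Prop :=
  [/\ [set: nat] #< [set: kappa], regular kappa & strong_limit kappa].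

(* Sets are rendered as types, which carry no rank: since kappa is inaccessible,
   a set is in bijection with a set of rank less than kappa if and only if its
   cardinality is less than kappa. *)
Definition small (kappa : cardinal) (X : Type) : Prop :=
  [set: X] #< [set: kappa].

Definition Small_below (kappa alpha : cardinal) : set Type :=
  [set X | small kappa X /\ [set: X] #< [set: alpha]].

(* When alpha <= kappa, every cardinal below alpha is small. *)
Definition Card_below (alpha : cardinal) : set Type :=
  [set X | exists2 b : alpha,
     is_cardinal_below b & X = {x : alpha | clt x b}].

Record arity (JJ : set Type) := Arity {
  arity_sort :> Type;
  arityP : JJ arity_sort
}.

Record operation (JJ : set Type) (A : Type) := Operation {
  op_arity : arity JJ;
  op_fun :> (op_arity -> A) -> A
}.

Record signature (JJ : set Type) := Signature {
  symbol :> Type;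
  symbol_arity : symbol -> arity JJ
}.

Record algebra (JJ : set Type) (Sigma : signature JJ) := Algebra {
  carrier :> Type;
  interp : forall s : Sigma, (symbol_arity s -> carrier) -> carrier
}.

Definition is_hom (JJ : set Type) (Sigma : signature JJ)
    (B C : algebra Sigma) (h : B -> C) : Prop :=
  forall (s : Sigma) (b : symbol_arity s -> B),
    h (interp b) = interp (h \o b).

Definition power (JJ : set Type) (Sigma : signature JJ) (A : algebra Sigma)
    (Y : Type) : algebra Sigma :=
  @Algebra JJ Sigma (Y -> A) (fun s b y => interp (fun j => b j y)).

Definition basic_operations (JJ : set Type) (Sigma : signature JJ)
    (A : algebra Sigma) : set (operation JJ A) :=
  range (fun s : Sigma => Operation (@interp JJ Sigma A s)).

Arguments basic_operations {JJ Sigma} A.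

Definition projection (A : Type) (J : Type) (j : J) : (J -> A) -> A :=
  fun a => a j.

Definition is_clone (JJ : set Type) (A : Type) (F : set (operation JJ A)) :
    Prop :=
  (forall (J : arity JJ) (j : J), F (@Operation JJ A J (projection j))) /\
  (forall (J K : arity JJ) (f : (K -> A) -> A) (g : K -> (J -> A) -> A),
     F (Operation f) -> (forall k, F (Operation (g k))) ->
     F (@Operation JJ A J (fun a => f (fun k => g k a)))).

Definition derived_operations (JJ : set Type) (Sigma : signature JJ)
    (A : algebra Sigma) : set (operation JJ A) :=
  smallest (@is_clone JJ A) (basic_operations A).

Arguments derived_operations {JJ Sigma} A.

Definition commute (A X Y : Type) (f : (X -> A) -> A) (g : (Y -> A) -> A) :
    Prop :=
  forall a : X -> Y -> A,
    g (fun y => f (fun x => a x y)) = f (fun x => g (fun y => a x y)).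

Definition centralizer (JJ : set Type) (A : Type) (G : set (operation JJ A)) :
    set (operation JJ A) :=
  [set f : operation JJ A | forall g, G g -> commute f g].

Definition unit_map (JJ : set Type) (Sigma : signature JJ) (A : algebra Sigma)
    (J : Type) : J -> power A (J -> A) :=
  fun j => @projection A J j.
Arguments unit_map {JJ Sigma} A J.

(* Main.v *)
(* A homomorphism h : A^(A^J) -> A is the same as an (A^J)-ary operation commuting
   with the basic ones.  If f commutes with h, then evaluating at the matrix
   a_{j,x} = x_j gives h f = f (h o u_J).  Conversely, if f fails to commute with
   some g in the centralizer at a matrix a = (a_{jk}), then
   h p := g (k |-> p (a_{.k})) is a homomorphism with h f <> f (h o u_J).
   The cardinality hypotheses only serve to bring the arity A^J into JJ: A^J is
   alpha-small, so it embeds into some alpha-small cardinal K, and h extends to a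
   K-ary operation by restricting its arguments along the embedding. *)
Require Import Defs.
From mathcomp Require Import all_boot.
From mathcomp Require Import mathcomp_extra boolp classical_sets functions.
From mathcomp Require Import cardinality wochoice.

Set Implicit Arguments.
Unset Strict Implicit.
Unset Printing Implicit Defensive.

Local Open Scope classical_set_scope.
Local Open Scope card_scope.

Lemma well_order_total (T : Type) (le : rel T) : well_order le -> total le.
Proof.
move=> wo x y.
exact: (@wo_chainW {classic T} le predT (withinW wo) x y isT isT).
Qed.

Lemma well_order_anti (T : Type) (le : rel T) :
  well_order le -> antisymmetric le.
Proof.
move=> wo x y.
exact: (@wo_chain_antisymmetric {classic T} le predT (withinW wo) x y isT isT).
Qed.

(** Take the least element of {x, y, z}: if it is x the claim is immediate, and if it is y or z then
    antisymmetry identifies two neighbours of the chain. *)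
Lemma well_order_trans (T : Type) (le : rel T) : well_order le -> transitive le.
Proof.
move=> wo y x z xy yz; have anti := well_order_anti wo.
have [|t [[/asboolP txyz tmin] _]] :=
    wo [pred t | `[< [\/ t = x, t = y | t = z] >]].
  by exists x; apply/asboolP; constructor 1.
have tle u : [\/ u = x, u = y | u = z] -> le t u.
  by move=> ?; apply: tmin; apply/asboolP.
case: txyz tle => -> tle; first by apply: tle; constructor 3.
- by rewrite (anti x y) // xy tle //; constructor 1.
- by rewrite -(anti y z) // yz tle //; constructor 2.
Qed.

Lemma clt_min (alpha : cardinal) (P : alpha -> Prop) (b : alpha) :
  P b -> exists2 m, P m & forall c, clt c m -> ~ P c.
Proof.
move=> Pb.
have [|m [[/asboolP Pm mmin] _]] := @cle_well_order alpha [pred x | `[< P x >]].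
  by exists b; apply/asboolP.
by exists m => // c /negP cm Pc; apply/cm/mmin/asboolP.
Qed.

Lemma segment_subset (alpha : cardinal) (b c : alpha) :
  cle b c -> [set x | clt x b] `<=` [set x | clt x c].
Proof.
move=> bc x; apply: contra => /(well_order_trans (@cle_well_order alpha) bc).
exact.
Qed.

Lemma card_le_injP (T U : Type) (B : set U) :
  [set: T] #<= B <-> exists2 f : T -> U, (forall x, B (f x)) & injective f.
Proof.
split=> [/card_leP[f]|[f fB fI]].
  pose t (x : T) : [set: T] := SigSub (mem_set (I : [set: T] x)).
  have fI : injective f by move=> x y; apply: (@inj _ _ _ f); rewrite inE.
  exists (fun x => val (f (t x))) => [x|x y]; first exact/set_mem/valP.
  by move=> /val_inj/fI/(congr1 val).
apply: card_le_trans (subset_card_le (_ : range f `<=` B)).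
  by have := inj_card_eq (in2W fI : {in [set: T] &, injective f});
     rewrite card_eq_le => /andP[].
by move=> _ [x _ <-].
Qed.

Lemma card_le_lt_trans (T U V : Type) (A : set T) (B : set U) (C : set V) :
  A #<= B -> B #< C -> A #< C.
Proof.
move=> AB [BC nBC]; split; first exact: card_le_trans BC.
apply: contra nBC; rewrite !card_eq_le => /andP[_ CA].
by rewrite BC (card_le_trans CA AB).
Qed.

(** Regularity bounds the range of an injection of [T] into [alpha]. The least bound whose segment
    receives [T] is a cardinal: an equipotent shorter segment would receive [T] too. *)
Lemma card_lt_segment (alpha : cardinal) (T : Type) :
  regular alpha -> [set: T] #< [set: alpha] ->
  exists2 b : alpha, is_cardinal_below b & [set: T] #<= [set x | clt x b].
Proof.
move=> [_ cof] Talpha; have [/card_le_injP[f _ fI] _] := Talpha.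
have [|b fb] := cof (range f).
  exact: card_le_lt_trans (card_image_le f setT) Talpha.
have Tb : [set: T] #<= [set x | clt x b].
  by apply/card_le_injP; exists f => // x; apply: fb; exists x.
have [m Tm mmin] :=
  clt_min (P := fun c => [set: T] #<= [set x | clt x c]) Tb.
exists m => // c cm; split.
  apply/subset_card_le/segment_subset.
  by have := well_order_total (@cle_well_order alpha) c m; rewrite (negPf cm) orbF.
apply/negP; rewrite card_eq_le => /andP[_ mc].
exact: mmin cm (card_le_trans Tm mc).
Qed.

Lemma card_lt_powerset (alpha : cardinal) (T : Type) :
  regular alpha -> strong_limit alpha ->
  [set: T] #< [set: alpha] -> [set: T -> bool] #< [set: alpha].
Proof.
move=> reg lim /(card_lt_segment reg)[b bcard /card_le_injP[f fb fI]].
apply: card_le_lt_trans (lim b bcard); apply/card_le_injP.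
(* [F] sends a subset of [T] to its image under [f]. *)
pose F (p : T -> bool) (y : {x : alpha | clt x b}) :=
  `[< exists2 t, f t = sval y & p t >].
exists F => // p q Fpq; apply/funext => t.
have FE r : F r (exist _ (f t) (fb t)) = r t.
  by apply/asboolP/idP => [[u /fI ->]|rt] //; exists t.
by rewrite -FE Fpq FE.
Qed.

(* The sets S with x in S and S included in {x, y} are {x} and {x, y}. *)
Definition kuratowski (T : Type) (x y : T) : (T -> bool) -> bool :=
  fun S => `[< S x /\ forall z, S z -> z = x \/ z = y >].

Lemma kuratowski_inj (T : Type) (x y x' y' : T) :
  kuratowski x y = kuratowski x' y' -> x = x' /\ y = y'.
Proof.
move=> e; have xyE S := asbool_eq_equiv (congr1 (@^~ S) e).
have xx' : x = x'.
  (* The singleton {x} belongs to the first pair, hence to the second, so it contains x'. *)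
  have [+ _] := xyE (fun z => `[< z = x >]).
  by case=> [|/asboolP-> //]; split; [apply/asboolP|move=> z /asboolP; left].
rewrite -xx' in xyE *; split=> //.
(* Testing {x, y} and {x, y'} places y in {x, y'} and y' in {x, y}, which forces y = y' even when
   one of them is x. *)
pose S t z := `[< z = x \/ z = t >].
have memS t : S t x /\ forall z, S t z -> z = x \/ z = t.
  by split=> [|z /asboolP //]; apply/asboolP; left.
have [/(_ (memS y))[_ hy] _] := xyE (S y).
have [_ /(_ (memS y'))[_ hy']] := xyE (S y').
have [yx|//] : y = x \/ y = y' by apply: hy; apply/asboolP; right.
have [y'x|//] : y' = x \/ y' = y by apply: hy'; apply/asboolP; right.
by rewrite yx y'x.
Qed.

(* If T and U inject into C, then graphs inject T -> U into the triple powerset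
   of C, so that strong limits need no cardinal arithmetic for products. *)
Lemma card_lt_fun (alpha : cardinal) (T U : Type) :
  regular alpha -> strong_limit alpha ->
  [set: T] #< [set: alpha] -> [set: U] #< [set: alpha] ->
  [set: T -> U] #< [set: alpha].
Proof.
move=> reg lim Talpha Ualpha.
have [c Tc Uc] : exists2 c : alpha,
    [set: T] #<= [set x | clt x c] & [set: U] #<= [set x | clt x c].
  have [b _ Tb] := card_lt_segment reg Talpha.
  have [c _ Uc] := card_lt_segment reg Ualpha.
  have /orP[bc|cb] := well_order_total (@cle_well_order alpha) b c.
    by exists c => //; apply/(card_le_trans Tb)/subset_card_le/segment_subset.
  by exists b => //; apply/(card_le_trans Uc)/subset_card_le/segment_subset.
pose C : Type := [set x | clt x c].
have [cC Cc] : [set x | clt x c] #<= [set: C] /\ [set: C] #<= [set x | clt x c].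
  exact/card_eqPle/card_setT_sym.
have Calpha : [set: C] #< [set: alpha].
  exact: card_le_lt_trans Cc (cle_initial c).
have TC := card_le_trans Tc cC; have UC := card_le_trans Uc cC.
have /(card_lt_powerset reg lim)/(card_lt_powerset reg lim) := Calpha.
move=> /(card_lt_powerset reg lim); apply: card_le_lt_trans.
move: TC UC => /card_le_injP[i _ iI] /card_le_injP[k _ kI].
apply/card_le_injP.
exists (fun f Q => `[< exists t, Q = kuratowski (i t) (k (f t)) >]) => // f g fg.
apply/funext => t.
have /asboolP : `[< exists u, kuratowski (i t) (k (f t)) =
    kuratowski (i u) (k (g u)) >].
  rewrite -(congr1 (@^~ (kuratowski (i t) (k (f t)))) fg).
  by apply/asboolP; exists t.
by move=> [u e]; have [/iI <- /kI] := kuratowski_inj e.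
Qed.

Lemma commute_sym (A X Y : Type) (f : (X -> A) -> A) (g : (Y -> A) -> A) :
  Defs.commute f g -> Defs.commute g f.
Proof. by move=> fg a; rewrite (fg (fun x y => a y x)). Qed.

(** Projections commute with everything by computation; for a composite, move [p] past [f], then
    past each [g k]. *)
Lemma centralizer_clone (JJ : set Type) (A : Type) (G : set (operation JJ A)) :
  is_clone (centralizer G).
Proof.
split=> [J j g _ a //|J K f g Gf Gg p Gp a] /=.
rewrite (Gf p Gp (fun k y => g k (fun x => a x y))) /=.
by congr (f _); apply/funext => k; apply: Gg.
Qed.

Lemma sub_double_centralizer (JJ : set Type) (A : Type)
    (G : set (operation JJ A)) : G `<=` centralizer (centralizer G).
Proof. by move=> f Gf g Gg; apply/commute_sym/Gg. Qed.

Lemma derived_sub_double_centralizer (JJ : set Type) (Sigma : signature JJ)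
    (A : algebra Sigma) :
  derived_operations A `<=` centralizer (centralizer (basic_operations A)).
Proof.
by apply: smallest_sub; [apply: centralizer_clone|apply: sub_double_centralizer].
Qed.

Lemma hom_commute (JJ : set Type) (Sigma : signature JJ) (A : algebra Sigma)
    (Y : Type) (h : power A Y -> A) :
  is_hom h <-> forall s : Sigma, Defs.commute h (@interp JJ Sigma A s).
Proof.
split=> [hh s|hs s b]; first exact/commute_sym/hh.
exact: (commute_sym (hs s)).
Qed.

(** Serves both directions: with [i] an embedding it enlarges the arity of a homomorphism, and with
    [i] listing the columns of a matrix it makes a homomorphism out of an operation in the
    centralizer. *)
Lemma commute_precomp (A W X Y : Type) (i : Y -> X) (h : (Y -> A) -> A)
    (g : (W -> A) -> A) :
  Defs.commute h g -> Defs.commute (fun p : X -> A => h (p \o i)) g.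
Proof. by move=> hg a; apply: (hg (a \o i)). Qed.

(* Membership in the double centralizer only tests operations whose arity lies
   in JJ, whereas J -> A need not; [i] embeds it into an arity that does. *)
Lemma double_centralizer_hom (JJ : set Type) (Sigma : signature JJ)
    (A : algebra Sigma) (J K : arity JJ) (f : (J -> A) -> A) (i : (J -> A) -> K)
    (h : power A (J -> A) -> A) :
  injective i -> centralizer (centralizer (basic_operations A)) (Operation f) ->
  is_hom h -> h f = f (h \o unit_map A J).
Proof.
move=> iI Af /hom_commute hA.
have Gh : centralizer (basic_operations A)
    (@Operation JJ A K (fun p : K -> A => h (p \o i))).
  by move=> _ [s _ <-]; exact: (commute_precomp i (hA s)).
(* [A] might be empty a priori; [h f] supplies the default value of the retraction [r] off the image
   of [i]. *)
have a0 : J -> A by move=> _; exact: h f.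
have [r ri] : exists r : K -> J -> A, cancel i r.
  exists (fun k =>
    if pselect (exists x, i x = k) is left e then projT1 (cid e) else a0).
  move=> x; case: pselect => [e|[]]; last by exists x.
  exact: iI (projT2 (cid e)).
have rE (p : (J -> A) -> A) : (fun k => p (r k)) \o i = p.
  by apply/funext => x /=; rewrite ri.
(* Commutation is applied to the matrix with columns [r k]; along [i] these run through all of
   [J -> A]. *)
have hE : h ((fun k => f (r k)) \o i) =
    f (fun j => h ((fun k => projection j (r k)) \o i)).
  exact: (Af _ Gh (fun j k => r k j)).
rewrite rE in hE; rewrite hE; congr (f _).
by apply/funext => j; rewrite rE.
Qed.

Lemma mem_double_centralizer (JJ : set Type) (Sigma : signature JJ)
    (A : algebra Sigma) (J : arity JJ) (f : (J -> A) -> A) :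
  (forall h : power A (J -> A) -> A, is_hom h -> h f = f (h \o unit_map A J)) ->
  centralizer (centralizer (basic_operations A)) (Operation f).
Proof.
move=> hf g Gg a.
apply: (hf (fun p => g (fun k => p (fun j => a j k)))); apply/hom_commute => s.
apply: (commute_precomp (h := g) (fun k j => a j k)).
by apply: (Gg (Operation (@interp JJ Sigma A s))); exists s.
Qed.

Theorem corollary6p5
    (kappa : cardinal) (hkappa : inaccessible kappa)
    (alpha : cardinal) (halpha_kappa : [set: alpha] #<= [set: kappa])
    (halpha_regular : regular alpha) (halpha_strong : strong_limit alpha)
    (JJ : set Type)
    (hCard : Card_below alpha `<=` JJ)
    (hSmall : JJ `<=` Small_below kappa alpha)
    (Sigma : signature JJ) (A : algebra Sigma)
    (hA : Small_below kappa alpha A) :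
  centralizer (centralizer (basic_operations A)) = derived_operations A
  <->
  (forall (J : arity JJ) (f : (J -> A) -> A),
     ~ derived_operations A (Operation f) ->
     exists h : power A (J -> A) -> A,
       is_hom h /\ h f <> f (h \o unit_map A J)).
Proof.
have embed (J : arity JJ) : exists K : arity JJ,
    exists i : (J -> A) -> K, injective i.
  have [_ Jalpha] := hSmall _ (arityP J); have [_ Aalpha] := hA.
  have /(card_lt_segment halpha_regular)[b bcard /card_le_injP[f fb fI]] :=
    card_lt_fun halpha_regular halpha_strong Jalpha Aalpha.
  have JJb : JJ {x : alpha | clt x b} by apply: hCard; exists b.
  exists (Arity JJb); exists (fun x => exist _ (f x) (fb x)).
  by move=> x y /(congr1 sval)/fI.
split=> [<- J f nf|hf].
  (* If no homomorphism separated [f], then [f] would lie in the double centralizer. *)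
  apply: contra_notP nf => nh; apply: mem_double_centralizer => h hh.
  by apply: contra_notP nh => hf; exists h.
apply/seteqP; split; last exact: derived_sub_double_centralizer.
move=> [J f] Af; apply: contrapT => /hf[h [hh]]; apply.
have [K [i iI]] := embed J.
exact: double_centralizer_hom iI Af hh.
Qed.
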